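(* Let $R$ be a commutative ring with unity, $T(R)$ its total ring of fractions, and $E$ an $R$-submodule of $T(R)$ such that $E\cdot E\subseteq E$. Let $v:R\times (R+E)\twoheadrightarrow R\times ((R+E)/E)$ and $u:R\hookrightarrow R\times ((R+E)/E)$ be the natural ring homomorphisms defined by $v((x,r+e)):=(x,r+E)$ and $u(r):=(r,r+E)$, for $x,r\in R$ and $e\in E$. Then $v^{-1}(u(R))=R\Join E$. Therefore, if $v':R\Join E\twoheadrightarrow R$ is the canonical map $(r,r+e)\mapsto r$ and $u':R\Join E\hookrightarrow R\times (R+E)$ is the natural embedding, then the diagram $$\begin{array}{ccc} R\Join E & \xrightarrow{\ v'\ } & R\\ {\scriptstyle u'}\downarrow & & \downarrow{\scriptstyle u}\\ R\times (R+E) & \xrightarrow{\ v\ } & R\times ((R+E)/E)\end{array}$$ is a pullback.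
   Context: $T(R)$ is the localization of $R$ at the set of all its regular elements (non-zero-divisors), and $R\subseteq T(R)$. $R+E:=\{r+e\mid r\in R,\ e\in E\}$ is a subring of $T(R)$ containing $R$ as a subring and $E$ as an ideal. $R\Join E:=\{(r,r+e)\mid r\in R,\ e\in E\}$ is a subring of $R\times (R+E)$. *)

(* Defs.v *)
From HB Require Import structures.
From mathcomp Require Import all_boot all_order all_algebra.
From mathcomp Require Import generic_quotient ring_quotient.
From mathcomp Require Import boolp classical_sets.
From mathcomp Require Import ring.

Set Implicit Arguments.
Unset Strict Implicit.
Unset Printing Implicit Defensive.

Import GRing.Theory.
Local Open Scope ring_scope.
Local Open Scope quotient_scope.

(* Rings are [comPzRingType]s, so zero rings are allowed: even for a nonzero R *)
(* the ring (R + E) / E may be zero. The ideal quotients of ring_quotient.v    *)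
(* are not rings when the ideal is not proper, and the fractions of fraction.v *)
(* require an integral domain, hence the variants below.                       *)

Section Ratio.
Variable R : comPzRingType.

(* In a commutative ring, [GRing.lreg s] (multiplication by s is injective)    *)
(* says that s is not a zero-divisor.                                          *)
Record regratio := RegRatio {
  regfrac :> R * R;
  regfracP : `[< GRing.lreg regfrac.2 >]
}.

HB.instance Definition _ := [isSub for regfrac].
HB.instance Definition _ := [Choice of regratio by <:].

Implicit Types x y z : regratio.

Lemma regdenP x : GRing.lreg x.2.
Proof. exact/asboolP/regfracP. Qed.

Lemma regden1 : `[< GRing.lreg (1 : R) >].
Proof. exact/asboolP/lreg1. Qed.

Lemma regdenM x y : `[< GRing.lreg (x.2 * y.2) >].
Proof. by apply/asboolP/lregM; exact: regdenP. Qed.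

Definition embr (a : R) := @RegRatio (a, 1) regden1.
Definition addr_ratio x y :=
  @RegRatio (x.1 * y.2 + y.1 * x.2, x.2 * y.2) (regdenM x y).
Definition oppr_ratio x := @RegRatio (- x.1, x.2) (regfracP x).
Definition mulr_ratio x y := @RegRatio (x.1 * y.1, x.2 * y.2) (regdenM x y).

Definition equivr x y := x.1 * y.2 == y.1 * x.2.

Lemma equivr_refl : reflexive equivr.
Proof. by move=> x; rewrite /equivr. Qed.

Lemma equivr_sym : symmetric equivr.
Proof. by move=> x y; rewrite /equivr eq_sym. Qed.

Lemma equivr_trans : transitive equivr.
Proof.
move=> y x z; rewrite /equivr => /eqP xy /eqP yz; apply/eqP.
apply: (@regdenP y).
by rewrite mulrA [y.2 * x.1]mulrC xy mulrAC yz mulrAC mulrC.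
Qed.

Canonical equivr_equiv := EquivRel equivr equivr_refl equivr_sym equivr_trans.

End Ratio.

Definition totfrac (R : comPzRingType) := {eq_quot @equivr R}.

Section TotFrac.
Variable R : comPzRingType.
Local Notation T := (totfrac R).
Implicit Types x y z : regratio R.

HB.instance Definition _ : EqQuotient _ (@equivr R) T := EqQuotient.on T.
HB.instance Definition _ := Choice.on T.

Lemma eq_totfrac x y : x.1 * y.2 = y.1 * x.2 -> \pi_T x = \pi_T y.
Proof. by move=> xy; apply/eqmodP; apply/eqP. Qed.

Lemma repr_totfrac x : (repr (\pi_T x)).1 * x.2 = x.1 * (repr (\pi_T x)).2.
Proof. by have /eqmodP/eqP := reprK (\pi_T x). Qed.

Definition tofrac0 : T := \pi_T (embr 0).
Definition tofrac1 : T := \pi_T (embr 1).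
Definition addt : T -> T -> T := lift_op2 T (@addr_ratio R).
Definition oppt : T -> T := lift_op1 T (@oppr_ratio R).
Definition mult : T -> T -> T := lift_op2 T (@mulr_ratio R).

Lemma addtE x y : addt (\pi_T x) (\pi_T y) = \pi_T (addr_ratio x y).
Proof.
unlock addt; apply: eq_totfrac => /=.
move: (repr (\pi_T x)) (repr_totfrac x) => [[a s] /= _] ex.
move: (repr (\pi_T y)) (repr_totfrac y) => [[b t] /= _] ey.
transitivity (a * x.2 * (t * y.2) + b * y.2 * (s * x.2)); first by ring.
by rewrite ex ey; ring.
Qed.

Lemma opptE x : oppt (\pi_T x) = \pi_T (oppr_ratio x).
Proof. by unlock oppt; apply: eq_totfrac; rewrite /= !mulNr repr_totfrac. Qed.

Lemma multE x y : mult (\pi_T x) (\pi_T y) = \pi_T (mulr_ratio x y).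
Proof. by unlock mult; apply: eq_totfrac; rewrite /= mulrACA !repr_totfrac mulrACA. Qed.

Fact addtA : associative addt.
Proof.
elim/quotW=> x; elim/quotW=> y; elim/quotW=> z; rewrite !addtE.
by apply: eq_totfrac => /=; ring.
Qed.

Fact addtC : commutative addt.
Proof.
elim/quotW=> x; elim/quotW=> y; rewrite !addtE.
by apply: eq_totfrac => /=; ring.
Qed.

Fact add0t : left_id tofrac0 addt.
Proof. by elim/quotW=> x; rewrite addtE; apply: eq_totfrac => /=; ring. Qed.

Fact addNt : left_inverse tofrac0 oppt addt.
Proof.
by elim/quotW=> x; rewrite opptE addtE; apply: eq_totfrac => /=; ring.
Qed.

HB.instance Definition _ := GRing.isZmodule.Build T addtA addtC add0t addNt.

Fact multA : associative mult.
Proof.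
elim/quotW=> x; elim/quotW=> y; elim/quotW=> z; rewrite !multE.
by apply: eq_totfrac => /=; ring.
Qed.

Fact multC : commutative mult.
Proof.
elim/quotW=> x; elim/quotW=> y; rewrite !multE.
by apply: eq_totfrac => /=; ring.
Qed.

Fact mul1t : left_id tofrac1 mult.
Proof. by elim/quotW=> x; rewrite multE; apply: eq_totfrac => /=; ring. Qed.

Fact multDl : left_distributive mult addt.
Proof.
elim/quotW=> x; elim/quotW=> y; elim/quotW=> z; rewrite !(multE, addtE).
by apply: eq_totfrac => /=; ring.
Qed.

HB.instance Definition _ :=
  GRing.Zmodule_isComPzRing.Build T multA multC mul1t multDl.

Definition to_totfrac (a : R) : T := \pi_T (embr a).

Fact to_totfrac_is_zmod_morphism : zmod_morphism to_totfrac.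
Proof.
move=> a b; rewrite -[RHS]/(addt _ (oppt _)) opptE addtE.
by apply: eq_totfrac => /=; ring.
Qed.
HB.instance Definition _ :=
  GRing.isZmodMorphism.Build R T to_totfrac to_totfrac_is_zmod_morphism.

Fact to_totfrac_is_monoid_morphism : monoid_morphism to_totfrac.
Proof.
by split=> // a b; rewrite -[RHS]/(mult _ _) multE; apply: eq_totfrac => /=; ring.
Qed.
HB.instance Definition _ :=
  GRing.isMonoidMorphism.Build R T to_totfrac to_totfrac_is_monoid_morphism.

(* The next three facts characterize T(R) as the localization of R at its      *)
(* regular elements.                                                           *)
Lemma to_totfrac_inj : injective to_totfrac.
Proof. by move=> a b /eqmodP /eqP /=; rewrite !mulr1. Qed.

Lemma to_totfrac_reg (s : R) : GRing.lreg s -> exists t : T, to_totfrac s * t = 1.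
Proof.
move=> /asboolP reg_s; exists (\pi_T (@RegRatio _ (1, s) reg_s)).
by rewrite -[LHS]/(mult _ _) multE; apply: eq_totfrac => /=; ring.
Qed.

Lemma totfracP (t : T) :
  exists a s : R, GRing.lreg s /\ t * to_totfrac s = to_totfrac a.
Proof.
elim/quotW: t => x; exists x.1, x.2; split; first exact: regdenP.
by rewrite -[LHS]/(mult _ _) multE; apply: eq_totfrac => /=; ring.
Qed.

Definition scalet (a : R) (t : T) : T := to_totfrac a * t.

Fact scaletA a b t : scalet a (scalet b t) = scalet (a * b) t.
Proof. by rewrite /scalet mulrA rmorphM. Qed.

Fact scale1t : left_id 1 scalet.
Proof. by move=> t; rewrite /scalet rmorph1 mul1r. Qed.

Fact scaletDr : right_distributive scalet +%R.
Proof. by move=> a s t; rewrite /scalet mulrDr. Qed.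

Fact scaletDl t : {morph scalet^~ t : a b / a + b}.
Proof. by move=> a b; rewrite /scalet rmorphD mulrDl. Qed.

HB.instance Definition _ :=
  GRing.Zmodule_isLmodule.Build R T scaletA scale1t scaletDr scaletDl.

Lemma scaletE (a : R) (t : T) : a *: t = to_totfrac a * t.
Proof. by []. Qed.

End TotFrac.

Arguments to_totfrac {R} a.

HB.mixin Record isIdeal (A : comPzRingType) (I : {pred A}) := {
  idealM : forall a, {in I, forall x, a * x \in I}
}.

(* Not necessarily proper ideals.                                              *)
#[short(type="ideal")]
HB.structure Definition Ideal (A : comPzRingType) :=
  {I of GRing.ZmodClosed A I & isIdeal A I}.

Definition quotring (A : comPzRingType) (I : ideal A) : Type :=
  {ideal_quot I}.

Section QuotRing.
Variables (A : comPzRingType) (I : ideal A).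
Local Notation Q := (quotring I).

HB.instance Definition _ := GRing.Zmodule.on Q.

Definition quot_pi (a : A) : Q := \pi_({ideal_quot I}) a.

Lemma quot_piP (a b : A) : quot_pi a = quot_pi b <-> a - b \in I.
Proof. by rewrite Quotient.idealrBE; split=> /eqP. Qed.

Lemma quot_pi_surj (q : Q) : exists a, quot_pi a = q.
Proof. by exists (repr (q : {ideal_quot I})); rewrite /quot_pi reprK. Qed.

Fact quot_pi_is_zmod_morphism : zmod_morphism quot_pi.
Proof. exact: (@pi_is_zmod_morphism _ _ _ ({ideal_quot I})). Qed.
HB.instance Definition _ :=
  GRing.isZmodMorphism.Build A Q quot_pi quot_pi_is_zmod_morphism.

Definition quot_mul (p q : Q) : Q :=
  quot_pi (repr (p : {ideal_quot I}) * repr (q : {ideal_quot I})).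

Lemma quot_mulE a b : quot_mul (quot_pi a) (quot_pi b) = quot_pi (a * b).
Proof.
apply/quot_piP; rewrite -/(quot_pi a) -/(quot_pi b).
set x := repr _; set y := repr _.
have xa : x - a \in I by apply/quot_piP; rewrite /quot_pi reprK.
have yb : y - b \in I by apply/quot_piP; rewrite /quot_pi reprK.
have -> : x * y - a * b = y * (x - a) + a * (y - b) by ring.
by rewrite rpredD ?idealM.
Qed.

Lemma quot_piW (P : Q -> Prop) : (forall a, P (quot_pi a)) -> forall q, P q.
Proof. by move=> Ppi q; have [a <-] := quot_pi_surj q. Qed.

Fact quot_mulA : associative quot_mul.
Proof.
by elim/quot_piW=> a; elim/quot_piW=> b; elim/quot_piW=> c; rewrite !quot_mulE mulrA.
Qed.

Fact quot_mulC : commutative quot_mul.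
Proof. by elim/quot_piW=> a; elim/quot_piW=> b; rewrite !quot_mulE mulrC. Qed.

Fact quot_mul1 : left_id (quot_pi 1) quot_mul.
Proof. by elim/quot_piW=> a; rewrite quot_mulE mul1r. Qed.

Fact quot_mulDl : left_distributive quot_mul +%R.
Proof.
elim/quot_piW=> a; elim/quot_piW=> b; elim/quot_piW=> c.
by rewrite -raddfD !quot_mulE -raddfD mulrDl.
Qed.

HB.instance Definition _ :=
  GRing.Zmodule_isComPzRing.Build Q quot_mulA quot_mulC quot_mul1 quot_mulDl.

Fact quot_pi_is_monoid_morphism : monoid_morphism quot_pi.
Proof. by split=> // a b; rewrite -[RHS]/(quot_mul _ _) quot_mulE. Qed.
HB.instance Definition _ :=
  GRing.isMonoidMorphism.Build A Q quot_pi quot_pi_is_monoid_morphism.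

End QuotRing.

Arguments quot_pi {A} I a.

Section Amalgamation.
Variables (R : comPzRingType) (E : submodClosed (totfrac R)).
Hypothesis EE : GRing.mulr_2closed E.
Local Notation T := (totfrac R).

Fact subE_closedB : {in E &, forall e f, e - f \in E}.
Proof. by have [_] := GRing.submod_closedB (submodClosedP E). Qed.

(* R + E, as a subset of T(R). The hypothesis is not used; it is there so that *)
(* the ring structures below can be inferred.                                  *)
Definition sum_pred (_ : GRing.mulr_2closed E) : {pred T} :=
  fun t => `[< exists r e, e \in E /\ t = to_totfrac r + e >].

Lemma sum_predP t :
  reflect (exists r e, e \in E /\ t = to_totfrac r + e) (t \in sum_pred EE).
Proof. exact: asboolP. Qed.

Fact sum_subring_closed : subring_closed (sum_pred EE).
Proof.
split.
- by apply/sum_predP; exists 1, 0; rewrite rpred0 addr0 rmorph1.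
- move=> _ _ /sum_predP[r [e [eE ->]]] /sum_predP[s [f [fE ->]]].
  apply/sum_predP; exists (r - s), (e - f); split; first exact: subE_closedB.
  by rewrite rmorphB; ring.
- move=> _ _ /sum_predP[r [e [eE ->]]] /sum_predP[s [f [fE ->]]].
  apply/sum_predP; exists (r * s), (r *: f + s *: e + e * f).
  by rewrite !rpredD ?rpredZ ?EE //; split=> //; rewrite rmorphM !scaletE; ring.
Qed.

Record sum_ring := SumRing { sum_val :> T; sum_valP : sum_val \in sum_pred EE }.

HB.instance Definition _ := [isSub for sum_val].
HB.instance Definition _ := [Choice of sum_ring by <:].
HB.instance Definition _ :=
  GRing.SubChoice_isSubComPzRing.Build T (sum_pred EE) sum_ring sum_subring_closed.

Fact sum_incl_subproof r : to_totfrac r \in sum_pred EE.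
Proof. by apply/sum_predP; exists r, 0; rewrite rpred0 addr0. Qed.

Definition sum_incl (r : R) : sum_ring := SumRing (sum_incl_subproof r).

Fact sum_incl_is_zmod_morphism : zmod_morphism sum_incl.
Proof. by move=> a b; apply: val_inj; rewrite /= rmorphB. Qed.
HB.instance Definition _ :=
  GRing.isZmodMorphism.Build R sum_ring sum_incl sum_incl_is_zmod_morphism.

Fact sum_incl_is_monoid_morphism : monoid_morphism sum_incl.
Proof. by split=> [|a b]; apply: val_inj; rewrite /= ?rmorph1 ?rmorphM. Qed.
HB.instance Definition _ :=
  GRing.isMonoidMorphism.Build R sum_ring sum_incl sum_incl_is_monoid_morphism.

Definition sum_ideal : {pred sum_ring} := fun x => val x \in E.

Lemma sum_idealE x : (x \in sum_ideal) = (val x \in E).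
Proof. by []. Qed.

Fact sum_ideal_zmod_closed : zmod_closed sum_ideal.
Proof.
split=> [|x y]; rewrite !sum_idealE; first by rewrite rmorph0; exact: rpred0.
by move=> xE yE; rewrite rmorphB; exact: subE_closedB.
Qed.
HB.instance Definition _ :=
  GRing.isZmodClosed.Build sum_ring sum_ideal sum_ideal_zmod_closed.

Fact sum_idealM a : {in sum_ideal, forall x, a * x \in sum_ideal}.
Proof.
move=> x; rewrite !sum_idealE rmorphM /=.
have /sum_predP[r [e [eE ->]]] := sum_valP a => xE.
by rewrite mulrDl -scaletE rpredD ?rpredZ ?EE.
Qed.
HB.instance Definition _ := isIdeal.Build sum_ring sum_ideal sum_idealM.

Definition sum_quot : comPzRingType := quotring sum_ideal.

Definition map_v (z : R * sum_ring) : R * sum_quot :=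
  (z.1, quot_pi sum_ideal z.2).

Fact map_v_is_zmod_morphism : zmod_morphism map_v.
Proof. by move=> x y; rewrite /map_v /= rmorphB. Qed.
HB.instance Definition _ :=
  GRing.isZmodMorphism.Build (R * sum_ring)%type (R * sum_quot)%type map_v
    map_v_is_zmod_morphism.

Fact map_v_is_monoid_morphism : monoid_morphism map_v.
Proof. by split=> [|x y]; rewrite /map_v /= ?rmorph1 ?rmorphM. Qed.
HB.instance Definition _ :=
  GRing.isMonoidMorphism.Build (R * sum_ring)%type (R * sum_quot)%type map_v
    map_v_is_monoid_morphism.

Definition map_u (r : R) : R * sum_quot := (r, quot_pi sum_ideal (sum_incl r)).

Fact map_u_is_zmod_morphism : zmod_morphism map_u.
Proof. by move=> x y; rewrite /map_u /= !rmorphB. Qed.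
HB.instance Definition _ :=
  GRing.isZmodMorphism.Build R (R * sum_quot)%type map_u map_u_is_zmod_morphism.

Fact map_u_is_monoid_morphism : monoid_morphism map_u.
Proof. by split=> [|x y]; rewrite /map_u /= ?rmorph1 ?rmorphM. Qed.
HB.instance Definition _ :=
  GRing.isMonoidMorphism.Build R (R * sum_quot)%type map_u
    map_u_is_monoid_morphism.

Definition bowtie_pred : {pred R * sum_ring} :=
  fun z => `[< exists r e, [/\ e \in E, z.1 = r & val z.2 = to_totfrac r + e] >].

Lemma bowtie_predP z :
  reflect (exists r e, [/\ e \in E, z.1 = r & val z.2 = to_totfrac r + e])
          (z \in bowtie_pred).
Proof. exact: asboolP. Qed.

Fact bowtie_subring_closed : subring_closed bowtie_pred.
Proof.
split.
- by apply/bowtie_predP; exists 1, 0; split=> //=; rewrite ?rpred0 ?addr0 ?rmorph1.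
- move=> x y /bowtie_predP[r [e [eE xr xe]]] /bowtie_predP[s [f [fE ys yf]]].
  apply/bowtie_predP; exists (r - s), (e - f).
  split; rewrite ?subE_closedB //= ?xr ?ys //.
  by rewrite rmorphB -[sum_val x.2]/(val x.2) xe -[sum_val y.2]/(val y.2) yf; ring.
- move=> x y /bowtie_predP[r [e [eE xr xe]]] /bowtie_predP[s [f [fE ys yf]]].
  apply/bowtie_predP; exists (r * s), (r *: f + s *: e + e * f).
  split; rewrite ?rpredD ?rpredZ ?EE //= ?xr ?ys //.
  rewrite rmorphM !scaletE -[sum_val x.2]/(val x.2) xe.
  by rewrite -[sum_val y.2]/(val y.2) yf; ring.
Qed.

Record bowtie :=
  Bowtie { bowtie_val :> R * sum_ring; bowtie_valP : bowtie_val \in bowtie_pred }.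

HB.instance Definition _ := [isSub for bowtie_val].
HB.instance Definition _ := [Choice of bowtie by <:].
HB.instance Definition _ :=
  GRing.SubChoice_isSubComPzRing.Build (R * sum_ring)%type bowtie_pred bowtie
    bowtie_subring_closed.

Definition map_u' (z : bowtie) : R * sum_ring := val z.

Fact map_u'_is_zmod_morphism : zmod_morphism map_u'.
Proof. exact: rmorphB. Qed.
HB.instance Definition _ :=
  GRing.isZmodMorphism.Build bowtie (R * sum_ring)%type map_u'
    map_u'_is_zmod_morphism.

Fact map_u'_is_monoid_morphism : monoid_morphism map_u'.
Proof. by split; [exact: rmorph1 | exact: rmorphM]. Qed.
HB.instance Definition _ :=
  GRing.isMonoidMorphism.Build bowtie (R * sum_ring)%type map_u'
    map_u'_is_monoid_morphism.

Definition map_v' (z : bowtie) : R := (val z).1.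

Fact map_v'_is_zmod_morphism : zmod_morphism map_v'.
Proof. by move=> x y; rewrite /map_v' rmorphB. Qed.
HB.instance Definition _ :=
  GRing.isZmodMorphism.Build bowtie R map_v' map_v'_is_zmod_morphism.

Fact map_v'_is_monoid_morphism : monoid_morphism map_v'.
Proof. by split=> [|x y]; rewrite /map_v' ?rmorph1 ?rmorphM. Qed.
HB.instance Definition _ :=
  GRing.isMonoidMorphism.Build bowtie R map_v' map_v'_is_monoid_morphism.

(* v (x, r + e) = (x, r + E), together with the properties of the four maps    *)
(* that are indicated by the shapes of their arrows.                           *)
Lemma map_vE (x r : R) (e : T) (re : to_totfrac r + e \in sum_pred EE) :
  e \in E -> map_v (x, SumRing re) = (x, quot_pi sum_ideal (sum_incl r)).
Proof.
move=> eE; congr pair; apply/quot_piP.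
by rewrite sum_idealE rmorphB /= addrC addKr.
Qed.

Lemma map_v_surj z : exists y, map_v y = z.
Proof.
by case: z => x q; have [a <-] := quot_pi_surj q; exists (x, a).
Qed.

Lemma map_u_inj : injective map_u.
Proof. by move=> x y []. Qed.

Lemma map_u'_inj : injective map_u'.
Proof. exact: val_inj. Qed.

Lemma map_v'_surj r : exists z, map_v' z = r.
Proof.
have rE : (r, sum_incl r) \in bowtie_pred.
  by apply/bowtie_predP; exists r, 0; rewrite rpred0 addr0.
by exists (Bowtie rE).
Qed.

End Amalgamation.

Arguments sum_incl {R E} EE r.
Arguments sum_ideal {R E} EE.
Arguments bowtie_pred {R E} EE.
Arguments map_v {R E} EE z.
Arguments map_u {R E} EE r.
Arguments map_u' {R E} EE z.
Arguments map_v' {R E} EE z.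

(* Pullback squares, with f the left, g the top, h the bottom and k the right  *)
(* map, in the category of commutative rings.                                  *)
Definition is_pullback (P A B C : comPzRingType)
    (f : {rmorphism P -> A}) (g : {rmorphism P -> B})
    (h : {rmorphism A -> C}) (k : {rmorphism B -> C}) : Prop :=
  h \o f =1 k \o g /\
  forall (X : comPzRingType) (a : {rmorphism X -> A}) (b : {rmorphism X -> B}),
    h \o a =1 k \o b ->
    exists m : {rmorphism X -> P},
      [/\ f \o m =1 a, g \o m =1 b &
          forall m' : {rmorphism X -> P},
            f \o m' =1 a -> g \o m' =1 b -> m' =1 m].

(* Main.v *)
From HB Require Import structures.
Require Import Defs.
From mathcomp Require Import all_boot all_order all_algebra.
From mathcomp Require Import boolp classical_sets.

Import GRing.Theory.
Local Open Scope ring_scope.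
Local Open Scope classical_set_scope.

(** The projection of R + E onto (R + E)/E has kernel E, so v(x, y) = u(r) says exactly that x = r
    and y - r lies in E, that is, that (x, y) lies in the subring [bowtie_pred EE] and has first
    component r. This is [eq_map_v_map_uP]; it gives the preimage at once. For the pullback it shows
    that a compatible pair (a, b) takes a into the subring, with b the first component of a, and
    [bowtie_lift] then supplies the mediating morphism. *)

Lemma eq_map_v_map_uP (R : comPzRingType) (E : submodClosed (totfrac R))
    (EE : GRing.mulr_2closed E) (z : R * sum_ring EE) (r : R) :
  map_v EE z = map_u EE r <-> z \in bowtie_pred EE /\ z.1 = r.
Proof.
case: z => x y; split.
  move=> [-> /quot_piP]; rewrite sum_idealE rmorphB /= => yE; split=> //.
  apply/bowtie_predP; exists r, (val y - to_totfrac r).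
  by split=> //=; rewrite addrC subrK.
case=> /bowtie_predP[s [e [eE /= -> ye]]] <-; congr pair.
apply/quot_piP.
by rewrite sum_idealE rmorphB /= ye addrC addKr.
Qed.

(** The operations of [bowtie EE] are inherited from the product, so the corestriction of [a] is a
    ring morphism because [val] is injective. *)
Lemma bowtie_lift (R : comPzRingType) (E : submodClosed (totfrac R))
    (EE : GRing.mulr_2closed E) (X : comPzRingType)
    (a : {rmorphism X -> R * sum_ring EE}) :
  (forall x, a x \in bowtie_pred EE) ->
  exists m : {rmorphism X -> bowtie EE}, map_u' EE \o m =1 a.
Proof.
move=> aP; pose m x : bowtie EE := Bowtie (aP x).
have mB : zmod_morphism m by move=> x y; apply: val_inj; rewrite /= rmorphB.
have mM : monoid_morphism m.
  by split=> [|x y]; apply: val_inj; rewrite /= ?rmorph1 ?rmorphM.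
pose mBm := GRing.isZmodMorphism.Build X (bowtie EE) m mB.
pose mMm := GRing.isMonoidMorphism.Build X (bowtie EE) m mM.
pose M : {rmorphism X -> bowtie EE} := HB.pack m mBm mMm.
by exists M.
Qed.

Theorem proposition2p6 (R : comPzRingType) (E : submodClosed (totfrac R))
    (EE : GRing.mulr_2closed E) :
  map_v EE @^-1` range (map_u EE) = [set` bowtie_pred EE]
  /\ is_pullback (map_u' EE) (map_v' EE) (map_v EE) (map_u EE).
Proof.
split.
  apply/seteqP; split=> [z [r _] /esym /eq_map_v_map_uP[] //|z zE].
  by exists z.1 => //; apply/esym/eq_map_v_map_uP.
split=> [z|X a b ab].
  by apply/eq_map_v_map_uP; split=> //; exact: bowtie_valP.
(* Compatibility both places the values of [a] in the subring and determines [b] from [a]. *)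
have abP x : a x \in bowtie_pred EE /\ (a x).1 = b x.
  exact/eq_map_v_map_uP/ab.
have [m ma] := bowtie_lift _ _ EE _ a (fun x => (abP x).1).
exists m; split=> // [x|m' m'a _ x].
  by rewrite -(abP x).2 -ma.
(* Uniqueness: both candidates agree after the embedding [map_u']. *)
by apply: (@map_u'_inj _ _ EE); rewrite [RHS]ma -m'a.
Qed.
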